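(* Let $H$ be a separable, infinite dimensional real Hilbert space and let $C\subseteq H$ be a closed, convex, somewhat bounded, locally uniformly rotund (LUR) set. Then there exists a residual set $\mathcal{R}\subseteq\mathcal{N}(C)$ such that every $f\in\mathcal{R}$ has a unique fixed point and, for every $x\in C$, the sequence of iterates $(f^k(x))_{k\in\mathbb{N}}$ converges (in norm) to the fixed point of $f$.
   Context: For a subset $C$ of a Hilbert space $H$ with norm $\|\cdot\|$, $\mathcal{N}(C)$ denotes the set of all nonexpansive mappings $f\colon C\to C$, i.e. mappings with $\|f(x)-f(y)\|\le\|x-y\|$ for all $x,y\in C$. It is endowed with the topology of pointwise convergence, i.e. the coarsest topology containing all sets $\{g\in\mathcal{N}(C): \|g(x)-f(x)\|<\varepsilon\}$ with $f\in\mathcal{N}(C)$, $x\in C$, $\varepsilon>0$. $f^k$ denotes the $k$-fold composition of $f$ with itself. A nonempty, non-singleton convex set $C$ in an infinite dimensional Hilbert space $H$ is called somewhat bounded if there are $x_0\in C$, a finite dimensional subspace $F\subseteq H$ and $\alpha>0$ such that $\alpha B_F\subseteq C-x_0$ and $F^\perp\cap(C-x_0)$ is bounded. Here $B_F$ is the closed unit ball of $F$ and $F^\perp$ the orthogonal complement of $F$ in $H$. Let $\partial C$ be the boundary of $C$ in $H$ and $\mathrm{dist}(x,A)=\inf\{\|x-a\|: a\in A\}$. For $x\in C$ set $\Delta_C(x)=\sup\{\|y-x\|: y\in C\}\in[0,\infty]$, and for $\varepsilon\in(0,\Delta_C(x))$ set $$\delta_C(x,\varepsilon)=\inf\Bigl\{\mathrm{dist}\Bigl(\frac{x+y}{2},\partial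 C\Bigr): y\in C,\ \|y-x\|\ge\varepsilon\Bigr\}.$$ A closed convex set $C\subseteq H$ is locally uniformly rotund (LUR) if $\partial C\neq\varnothing$ and $\delta_C(x,\varepsilon)>0$ for every $x\in C$ and every $\varepsilon\in(0,\Delta_C(x))$. A subset of a topological space is meager if it is a countable union of nowhere dense sets, and residual if its complement is meager. *)

(* Defs.v *)
From HB Require Import structures.
From mathcomp Require Import all_boot all_order all_algebra sesquilinear.
From mathcomp Require Import all_classical all_reals all_analysis.

Set Implicit Arguments.
Unset Strict Implicit.
Unset Printing Implicit Defensive.

Import Order.TTheory GRing.Theory Num.Theory.
Import numFieldNormedType.Exports.

Local Open Scope classical_set_scope.
Local Open Scope ring_scope.

Section BaireCategory.
Context {T : topologicalType}.
Implicit Types A : set T.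

Definition boundary A : set T := closure A `\` A°.

Definition nowhere_dense A : Prop := (closure A)° = set0.

Definition meager A : Prop :=
  exists F : (set T)^nat, (forall n, nowhere_dense (F n)) /\
    A = \bigcup_n F n.

Definition residual A : Prop := meager (~` A).

End BaireCategory.

Definition separable (T : topologicalType) : Prop :=
  exists2 D : set T, countable D & dense D.

Section LinearSpan.
Context {R : realType} {V : lmodType R}.

Definition lspan n (e : 'I_n -> V) : set V :=
  [set \sum_(i < n) a i *: e i | a in [set: 'I_n -> R]].

Definition finite_dim_subspace (F : set V) : Prop :=
  exists n (e : 'I_n -> V), F = lspan e.

Definition infinite_dimensional : Prop := ~ finite_dim_subspace [set: V].

Definition orthogonal_complement (dot : V -> V -> R) (F : set V) : set V :=
  [set v | forall w, F w -> dot w v = 0].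

End LinearSpan.
Arguments infinite_dimensional {R} V.

Section ConvexSets.
Context {R : realType} {H : completeNormedModType R}.
Implicit Types (C F : set H) (x y : H).

(* Convexity of [C] and infinite-dimensionality of [H] are standing assumptions
   of this notion and are required separately. *)
Definition somewhat_bounded (dot : H -> H -> R) C : Prop :=
  [/\ C !=set0,
      ~ (exists a, C = [set a]) &
      exists x0 F (alpha : R),
        [/\ C x0, finite_dim_subspace F, 0 < alpha,
            [set alpha *: v | v in F `&` [set v | `|v| <= 1]]
              `<=` [set y - x0 | y in C] &
            bounded_set
              (orthogonal_complement dot F `&` [set y - x0 | y in C])]].

Local Open Scope ereal_scope.

Definition Delta C x : \bar R := ereal_sup [set `|y - x|%:E | y in C].

Definition delta C x (eps : R) : \bar R :=
  ereal_inf [set edist_inf (boundary C) (2^-1 *: (x + y))%R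
            | y in C `&` [set y | eps <= `|y - x|]%R].

(* Closedness and convexity of [C] are required separately. *)
Definition locally_uniformly_rotund C : Prop :=
  boundary C !=set0 /\
  forall x, C x -> forall eps : R,
    (0 < eps)%R -> eps%:E < Delta C x -> 0 < delta C x eps.

End ConvexSets.

(* The coercion of [C : set H] to a type is used throughout: [{ptws C -> C}] has
   the topology of pointwise convergence, [C] having the norm topology of [H],
   and [nonexp_maps C], seen as a type, has the subspace topology. *)
Definition nonexp_maps {R : realType} {H : completeNormedModType R} (C : set H)
    : set {ptws C -> C} :=
  [set f | forall x y : C, `|\val (f x) - \val (f y)| <= `|\val x - \val y|].
Arguments nonexp_maps {R H} C.

(* Main.v *)
Require Import Defs.
From HB Require Import structures.
From mathcomp Require Import all_boot all_order all_algebra sesquilinear.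
From mathcomp Require Import all_classical all_reals all_analysis.
From mathcomp Require Import ring lra.
Import Order.TTheory GRing.Theory Num.Theory.
Import numFieldNormedType.Exports.
Local Open Scope classical_set_scope.
Local Open Scope ring_scope.

(** Two properties of a nonexpansive map f are shown to be generic, and together
they give the conclusion.

The first is that any two orbits merge: |f^k x - f^k y| tends to 0 for all
x, y. As f is nonexpansive, it is enough to know, for x and y in a countable
dense subset of C and for every tolerance 1 / (m + 1), that the distance
falls below the tolerance for some k. Each of these countably many
conditions is open for pointwise convergence and holds for strict
contractions, and the contractions (1 - t) f + t x0 are dense. Once orbits
merge, a fixed point is unique and attracts every orbit
([merging_iterates_cvg]); only its existence remains.

The second is that f has a fixed point; the set of maps with a fixed point
contains a dense open set ([fixpoint_maps_interior_dense]). Approximate f by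
a contraction g0 = (1 - t) f + t x0, with fixed point p, and then g0 by a
map g that takes the constant value p on a small ball around p
([locally_constant_dense]). Let e_1, ..., e_n span the finite dimensional
space F that witnesses that C is somewhat bounded. Since p is a convex
combination with weight t > 0 on x0, the points z = p +- rho e_i belong to C
for rho small. If h is any nonexpansive map with |h z - p| < eta for these
finitely many z, then |h x - p| <= |x - z| + eta. Now a point x of C far
from p satisfies |<x - p, e_i>| >= c |x - p| for some i and some constant
c > 0, because the part of C orthogonal to F is bounded and C is convex
([norm_le_coordinates]); so one of the z is closer to x than p by an amount
that exceeds eta, and |h x - p| <= |x - p|
([boundary_condition_near_constant]). A nonexpansive map that does not move
far points away from p has a fixed point, by a Hilbert space argument
([fixpoint_of_boundary_condition]). Thus all the maps in a neighbourhood of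
g have fixed points. *)

Set Implicit Arguments.
Unset Strict Implicit.
Unset Printing Implicit Defensive.

(** * Inner products *)

Section InnerProduct.
Context {R : realType} {H : completeNormedModType R} {dot : {dot H for idfun}}.
Hypothesis dot_norm : forall x : H, dot x x = `|x| ^+ 2.

Lemma dotC (x y : H) : dot x y = dot y x.
Proof. by rewrite hermC expr0 mul1r. Qed.

Lemma dotZr (a : R) (x y : H) : dot x (a *: y) = a * dot x y.
Proof. exact: linearZr_LR. Qed.

Lemma dotZl (a : R) (x y : H) : dot (a *: x) y = a * dot x y.
Proof. exact: linearZl_LR. Qed.

Lemma sqr_normD (x y : H) : `|x + y| ^+ 2 = `|x| ^+ 2 + 2 * dot x y + `|y| ^+ 2.
Proof.
rewrite -!dot_norm linearDl/= !linearDr/= (dotC y x); ring.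
Qed.

Lemma sqr_normB (x y : H) : `|x - y| ^+ 2 = `|x| ^+ 2 - 2 * dot x y + `|y| ^+ 2.
Proof. by rewrite sqr_normD normrN linearNr/= mulrN. Qed.

(** The Cauchy-Schwarz inequality. *)
Lemma normr_dot_le (x y : H) : `|dot x y| <= `|x| * `|y|.
Proof.
have sq t : 0 <= `|x| ^+ 2 + 2 * t * dot x y + t ^+ 2 * `|y| ^+ 2.
  have := sqr_ge0 `|x + t *: y|; rewrite sqr_normD dotZr normrZ exprMn.
  by rewrite (real_normK (num_real t)) mulrA.
have [y0|y0] := eqVneq y 0; first by rewrite y0 linear0r normr0 normr0 mulr0.
have ny : 0 < `|y| by rewrite normr_gt0.
(* The minimizer over t of the squared norm of x + t y. *)
have := sq (- dot x y / `|y| ^+ 2).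
have -> : `|x| ^+ 2 + 2 * (- dot x y / `|y| ^+ 2) * dot x y +
    (- dot x y / `|y| ^+ 2) ^+ 2 * `|y| ^+ 2 =
    ((`|x| * `|y|) ^+ 2 - dot x y ^+ 2) / `|y| ^+ 2.
  by field; rewrite gt_eqF.
rewrite pmulr_lge0 ?invr_gt0 ?exprn_gt0// subr_ge0.
rewrite -(real_normK (num_real (dot x y))).
by rewrite ler_sqr// nnegrE mulr_ge0.
Qed.

(** The map at hand moves every point by min(r, |y|) towards the origin: it
is the identity minus the metric projection onto the ball of radius r.
Expanding the squares and bounding [dot y z] by Cauchy-Schwarz reduces the
claim to the fact that [t |-> max(r, t) - r] is 1-Lipschitz. *)
Lemma radial_shrink_nonexpansive (r : R) (y z : H) : 0 < r ->
  `|(1 - r / Num.max r `|y|) *: y - (1 - r / Num.max r `|z|) *: z| <= `|y - z|.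
Proof.
move=> r0.
pose c (y : H) := 1 - r / Num.max r `|y|; rewrite -/(c y) -/(c z).
have c01 (u : H) : [/\ 0 <= c u, c u <= 1 & c u * `|u| = Num.max r `|u| - r].
  have m0 : 0 < Num.max r `|u| by rewrite lt_max r0.
  split.
  - by rewrite subr_ge0 ler_pdivrMr// mul1r le_max lexx.
  - by rewrite gerBl divr_ge0// ltW.
  - rewrite /c; have [ru|ur] := leP r `|u|.
      have u0 : 0 < `|u| by exact: lt_le_trans ru.
      by field; rewrite gt_eqF.
    by rewrite divff ?gt_eqF// subrr mul0r subrr.
have [y0 y1 yE] := c01 y; have [z0 z1 zE] := c01 z.
have lip : (c y * `|y| - c z * `|z|) ^+ 2 <= (`|y| - `|z|) ^+ 2.
  rewrite yE zE; have [ry|yr] := leP r `|y|; have [rz|zr] := leP r `|z|.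
  - lra.
  - have : 0 <= (r - `|z|) * ((`|y| - r) + (`|y| - `|z|)).
      by apply: mulr_ge0; lra.
    lra.
  - have : 0 <= (r - `|y|) * ((`|z| - r) + (`|z| - `|y|)).
      by apply: mulr_ge0; lra.
    lra.
  - have := sqr_ge0 (`|y| - `|z|); lra.
rewrite -ler_sqr ?nnegrE// !sqr_normB dotZr dotZl !normrZ !ger0_norm//.
have := normr_dot_le y z; move=> /(le_trans (ler_norm _)) d.
have : (1 - c y * c z) * dot y z <= (1 - c y * c z) * (`|y| * `|z|).
  by rewrite ler_wpM2l// subr_ge0 mulr_ile1.
nra.
Qed.

End InnerProduct.

(** * Projections onto finite dimensional subspaces *)

Section Lspan.
Context {R : realType} {V : lmodType R}.

Lemma lspanD n (e : 'I_n -> V) x y : lspan e x -> lspan e y -> lspan e (x + y).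
Proof.
move=> [a _ <-] [b _ <-]; exists (fun i => a i + b i) => //.
by rewrite -big_split/=; apply: eq_bigr => i _; rewrite scalerDl.
Qed.

Lemma lspanZ n (e : 'I_n -> V) c x : lspan e x -> lspan e (c *: x).
Proof.
move=> [a _ <-]; exists (fun i => c * a i) => //.
by rewrite scaler_sumr; apply: eq_bigr => i _; rewrite scalerA.
Qed.

Lemma lspan0 n (e : 'I_n -> V) : lspan e 0.
Proof. by exists (fun=> 0) => //; rewrite big1// => i _; rewrite scale0r. Qed.

Lemma lspan_gen n (e : 'I_n -> V) i : lspan e (e i).
Proof.
exists (fun j => (i == j)%:R) => //.
rewrite (bigD1 i)//= eqxx scale1r big1 ?addr0// => j ji.
by rewrite eq_sym (negbTE ji) scale0r.
Qed.

Lemma lspan_sub n m (e : 'I_n -> V) (f : 'I_m -> V) :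
  (forall i, lspan f (e i)) -> lspan e `<=` lspan f.
Proof.
move=> ef _ [a _ <-].
elim/big_ind: _ => [|x y|i _]; [exact: lspan0|exact: lspanD|].
exact: lspanZ.
Qed.

End Lspan.

Section Projection.
Context {R : realType} {H : completeNormedModType R} {dot : {dot H for idfun}}.
Hypothesis dot_norm : forall x : H, dot x x = `|x| ^+ 2.

Lemma orthogonal_lspan n (e : 'I_n -> H) v :
  (forall i, dot (e i) v = 0) -> orthogonal_complement dot (lspan e) v.
Proof.
move=> ev _ [a _ <-]; rewrite linear_sumlz/= big1// => i _.
by rewrite dotZl ev mulr0.
Qed.

(** The point u is the orthogonal projection of w. The bound on it says that
the numbers [dot w (e i)] control the component of w in the span, although
the vectors [e i] are arbitrary, possibly linearly dependent, generators. *)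
Lemma orthogonal_projection n (e : 'I_n -> H) :
  exists2 K : R, 0 <= K & forall (w : H) (m : R),
    0 <= m -> (forall i, `|dot w (e i)| <= m) ->
    exists u, [/\ lspan e u, `|u| <= K * m &
                  orthogonal_complement dot (lspan e) (w - u)].
Proof.
elim: n e => [|n IH] e.
  exists 0 => // w m m0 _; exists 0.
  split; [exact: lspan0|by rewrite normr0 mul0r|].
  by apply: orthogonal_lspan => -[].
pose e' i := e (widen_ord (leqnSn n) i).
have e'e : lspan e' `<=` lspan e by apply: lspan_sub => i; exact: lspan_gen.
have [K K0 KP] := IH e'.
(* One Gram-Schmidt step: b is the part of the last vector orthogonal to the
   span of the others. If b = 0, division by zero makes c and the extra term of
   the new constant vanish, as they should. *)
have [||a [ea _ ab]] := KP (e ord_max) (\sum_i `|dot (e ord_max) (e' i)|).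
- exact: sumr_ge0.
- by move=> i; rewrite (bigD1 i)//= lerDl sumr_ge0.
pose b := e ord_max - a.
exists (K + (1 + K * `|a|) / `|b|).
  by rewrite addr_ge0// divr_ge0// addr_ge0// mulr_ge0.
move=> w m m0 wm.
have [|u [eu um uw]] := KP w m m0; first by move=> i; exact: wm.
pose c := dot w b / `|b| ^+ 2.
have cb : c * `|b| ^+ 2 = dot w b.
  have [->|b0] := eqVneq b 0; first by rewrite linear0r normr0 expr0n mulr0.
  by rewrite /c divfK// expf_neq0// normr_eq0.
have ub : dot u b = 0 by exact: ab.
have wa : dot w a = dot u a.
  by apply/eqP; rewrite -subr_eq0 -linearBl/= (dotC); apply/eqP/uw.
have wb : `|dot w b| <= (1 + K * `|a|) * m.
  rewrite /b linearBr/= wa (le_trans (ler_normB _ _))// mulrDl mul1r lerD//.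
  by rewrite (le_trans (normr_dot_le dot_norm _ _))// mulrAC ler_wpM2r.
exists (u + c *: b); split.
- apply: lspanD; first exact: e'e.
  apply: lspanZ; apply: lspanD; first exact: lspan_gen.
  by rewrite -scaleN1r; apply: lspanZ; exact: e'e.
- rewrite (le_trans (ler_normD _ _))// mulrDl lerD// normrZ.
  have [->|b0] := eqVneq b 0; first by rewrite normr0 invr0 !mulr0 mul0r.
  have b1 : 0 < `|b| by rewrite normr_gt0.
  rewrite /c normrM [`|(_ ^+ 2)^-1|]ger0_norm ?invr_ge0 ?sqr_ge0//.
  rewrite (_ : _ / _ * _ = `|dot w b| / `|b|); last by field; rewrite gt_eqF.
  by rewrite mulrAC ler_pM2r ?invr_gt0.
- have o' i : dot (e' i) (w - (u + c *: b)) = 0.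
    have ei : lspan e' (e' i) by exact: lspan_gen.
    by rewrite opprD addrA linearBr/= (uw _ ei) dotZr (ab _ ei) mulr0 subr0.
  apply: orthogonal_lspan => i.
  have [[j ->]|->] : (exists j, i = widen_ord (leqnSn n) j) \/ i = ord_max.
  + case: (ltnP i n) => [ilt|ige]; [left|right].
      by exists (Ordinal ilt); apply: val_inj.
    by apply: val_inj; apply/eqP; rewrite /= eqn_leq ige -ltnS ltn_ord.
  + exact: o'.
  + rewrite -(subrK a (e ord_max)) linearDl/= -/b.
    rewrite [X in _ + X](orthogonal_lspan o' ea) addr0.
    rewrite linearBr/= linearDr/= dotZr dot_norm cb (dotC b u) ub add0r.
    by rewrite dotC subrr.
Qed.

End Projection.

(** * Fixed points of nonexpansive maps *)

Section ConvexSubset.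
Context {R : realType} {H : completeNormedModType R} {C : set H}.
Hypotheses (C_closed : closed C) (C_convex : convex_set C).

Lemma convex_mix (x y : H) (t : R) : 0 <= t <= 1 -> C x -> C y ->
  C ((1 - t) *: x + t *: y).
Proof.
move=> /andP[t0 t1] Cx Cy.
pose s : {i01 R} := Itv01 t0 t1.
have := @C_convex y x s (mem_set Cy) (mem_set Cx); rewrite inE.
by rewrite addrC.
Qed.

Lemma in_carrier (x : C) : C (\val x).
Proof. exact: set_valP. Qed.

Lemma corestriction (T : Type) (F : T -> H) : (forall x, C (F x)) ->
  exists f : T -> C, forall x, \val (f x) = F x.
Proof. by move=> CF; exists (fun x => exist _ (F x) (mem_set (CF x))). Qed.

Lemma contraction_has_fixpoint (q : R) (f : C -> C) :
  [set: C] !=set0 -> 0 <= q -> q < 1 ->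
  (forall x y, `|\val (f x) - \val (f y)| <= q * `|\val x - \val y|) ->
  exists p, f p = p.
Proof.
move=> [a _] q0 q1 fq.
(* [banach_fixed_point] speaks of functions on H that map C to itself, hence
   this extension of f by the identity. *)
pose F x :=
  if pselect (C x) is left h then \val (f (exist _ x (mem_set h))) else x.
have FE (x : C) : F (\val x) = \val (f x).
  rewrite /F; case: pselect => [h|]; last by have := in_carrier x.
  by congr (\val (f _)); apply: val_inj.
have Fh : {homo F : x / C x >-> C x}.
  move=> x Cx; rewrite -[x]/(\val (exist _ x (mem_set Cx) : C)) FE.
  exact: in_carrier.
pose F' : {fun C >-> C} := mkfun_fun Fh.
have ctr : is_contraction F'.
  exists (NngNum q0); split => //= -[x y] /= [Cx Cy].
  have := fq (exist _ x (mem_set Cx)) (exist _ y (mem_set Cy)).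
  by rewrite -!FE.
have [|p Cp pE] := banach_fixed_point ctr C_closed.
  by exists (\val a); exact: in_carrier.
exists (exist _ p (mem_set Cp)); apply: val_inj; rewrite -FE /=.
by rewrite [RHS]pE.
Qed.

End ConvexSubset.

Section FixedPoint.
Context {R : realType} {H : completeNormedModType R} {dot : {dot H for idfun}}.
Hypothesis dot_norm : forall x : H, dot x x = `|x| ^+ 2.
Context {C : set H}.
Hypotheses (C_closed : closed C) (C_convex : convex_set C).

(** If f is nonexpansive and u, v solve f u = (1 + a) u and f v = (1 + b) v,
the hypothesis holds. The conclusion is the monotonicity of the identity
minus f between u and v, written so that the norms of the solutions appear:
as the parameter decreases to 0, the norms of the solutions increase and
govern their distances. *)
Lemma monotone_resolvent (u v : H) (a b : R) :
  `|(1 + a) *: u - (1 + b) *: v| <= `|u - v| ->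
  (a + b) * `|u - v| ^+ 2 <= (a - b) * (`|v| ^+ 2 - `|u| ^+ 2).
Proof.
rewrite -(ler_pXn2r (n := 2))// ?nnegrE//.
have -> : (1 + a) *: u - (1 + b) *: v = (u - v) + (a *: u - b *: v).
  by rewrite !scalerDl !scale1r opprD addrACA.
rewrite (sqr_normD dot_norm (u - v)) => h.
have : 2 * dot (u - v) (a *: u - b *: v) <= 0.
  by have := sqr_ge0 `|a *: u - b *: v|; lra.
rewrite linearBl/= !linearBr/= !dotZr !dot_norm (dotC v u).
have := sqr_normB dot_norm u v.
move=> -> h2; nra.
Qed.

(** The squared norms increase and are bounded, hence converge, and the
distances are dominated by their increments. *)
Lemma cvg_of_sqr_norm_le (u : nat -> H) (B : R) :
  (forall n, `|u n| <= B) ->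
  (forall n m, (n < m)%N -> `|u n - u m| ^+ 2 <= `|u m| ^+ 2 - `|u n| ^+ 2) ->
  cvgn u.
Proof.
move=> uB uC.
pose a n := `|u n| ^+ 2.
have a_nd : nondecreasing_seq a.
  apply/nondecreasing_seqP => n; rewrite -subr_ge0.
  apply: le_trans (uC _ _ (ltnSn n)).
  exact: sqr_ge0.
have a_cvg : cvgn a.
  apply: nondecreasing_is_cvgn => //.
  exists (B ^+ 2) => _ [n _ <-]; rewrite /a ler_sqr ?nnegrE//.
  exact: le_trans (uB n).
apply/cauchy_cvgP/cauchy_exP => e e0.
have /cvgr_dist_lt /(_ (e ^+ 2)) := a_cvg.
rewrite exprn_gt0// => /(_ isT) [N _ /(_ N (leqnn N)) aN].
exists (u N); exists N.+1 => // m /= Nm.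
rewrite -ball_normE /= -(ltr_pXn2r (n := 2))// ?nnegrE// ?ltW//.
apply: (le_lt_trans (uC _ _ Nm)); apply: le_lt_trans aN.
apply: le_trans (ler_norm _); rewrite lerD2r.
by have := @nondecreasing_cvgn_le _ _ a_nd a_cvg m; rewrite /a.
Qed.

(** A fixed point theorem in the style of Browder and of Leray and Schauder:
if, outside a ball, f does not move points away from q, then the fixed
points x n of the contractions (1 - t) f + t q stay bounded. By
[monotone_resolvent] and [cvg_of_sqr_norm_le] they converge in norm as t
tends to 0, without any appeal to weak compactness, and the limit is fixed
by f. *)
Lemma fixpoint_of_boundary_condition (f : C -> C) (q : C) (B : R) :
  nonexp_maps C f ->
  (forall x, B < `|\val x - \val q| ->
    `|\val (f x) - \val q| <= `|\val x - \val q|) ->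
  exists p, f p = p.
Proof.
move=> f1 fB.
pose mu (n : nat) : R := n.+1%:R^-1.
have mu0 n : 0 < mu n by rewrite invr_gt0.
(* With t = 1 / (n + 2), the fixed point of (1 - t) f + t q satisfies this
   equation with mu n = t / (1 - t) = 1 / (n + 1). *)
have /choice[x xE] n : exists x : C,
    \val (f x) - \val q = (1 + mu n) *: (\val x - \val q).
  pose t : R := n.+2%:R^-1.
  have t01 : 0 <= t <= 1 by rewrite /t invr_ge0 ler0n/= invf_le1 ?ltr0n// ler1n.
  have t1 : 0 < 1 - t by rewrite subr_gt0 /t invf_lt1 ?ltr0n// ltr1n.
  have [|g gE] :=
      @corestriction _ _ C C (fun w => (1 - t) *: \val (f w) + t *: \val q).
    by move=> w; apply: convex_mix => //; exact: in_carrier.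
  have [||||p pE] := @contraction_has_fixpoint R H C C_closed (1 - t) g.
  - by exists q.
  - exact: ltW.
  - by rewrite ltrBlDr ltrDl invr_gt0.
  - move=> u v; rewrite !gE opprD addrACA subrr addr0 -scalerBr normrZ.
    by rewrite gtr0_norm// ler_pM2l.
  exists p.
  have {1}-> : \val p = (1 - t) *: \val (f p) + t *: \val q by rewrite -gE pE.
  have -> : 1 + mu n = (1 - t)^-1.
    rewrite /mu /t -[n.+2%:R]natr1.
    have : (0 : R) < n.+1%:R by rewrite ltr0n.
    by move: (n.+1%:R : R) => a a0; field; rewrite addrK !gt_eqF ?addr_gt0.
  apply: (@scalerI _ _ (1 - t)); first by rewrite gt_eqF.
  rewrite scalerA divff ?gt_eqF// scale1r scalerBr.
  by rewrite [(1 - t) *: \val q]scalerBl scale1r opprB addrA.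
pose y n := \val (x n) - \val q.
(* Where the norm of y n exceeds B, the factor 1 + mu n > 1 contradicts fB. *)
have yB n : `|y n| <= Num.max B 0.
  rewrite leNgt gt_max; apply/negP => /andP[/fB + y0].
  rewrite xE normrZ gtr0_norm ?addr_gt0//.
  rewrite -/(y n) -{2}[`|y n|]mul1r ler_pM2r// gerDl leNgt.
  by rewrite mu0.
have y_cvg : cvgn y.
  apply: (@cvg_of_sqr_norm_le y _ yB) => n m nm.
  have mnm : mu m < mu n by rewrite ltf_pV2 ?posrE// ltr_nat.
  have : (mu n + mu m) * `|y n - y m| ^+ 2 <=
      (mu n - mu m) * (`|y m| ^+ 2 - `|y n| ^+ 2).
    apply: monotone_resolvent; rewrite -!xE.
    by rewrite opprB addrA subrK /y opprB addrA subrK.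
  have := mu0 m; have := sqr_ge0 `|y n - y m|.
  set D := `|_ - _| ^+ 2; set E := _ - `|y n| ^+ 2 => D0 m0 h.
  have E0 : 0 <= E by nra.
  nra.
have x_cvg : cvgn (\val \o x).
  have -> : \val \o x = y \+ cst (\val q).
    by apply/funext => n /=; rewrite /y subrK.
  apply: is_cvgD => //; exact: is_cvg_cst.
have Cp : C (limn (\val \o x)).
  apply: (closed_cvg C C_closed _ _ x_cvg).
  by apply: nearW => n; exact: in_carrier.
pose p : C := exist _ (limn (\val \o x)) (mem_set Cp); exists p.
apply: val_inj; apply/eqP; rewrite -subr_eq0 -normr_le0.
apply/ler_addgt0Pl => e e0; rewrite addr0.
have mu_cvg : mu n * Num.max B 0 @[n --> \oo] --> 0.
  rewrite -[X in _ --> X](mul0r (Num.max B 0)).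
  by apply: cvgM; [exact: cvg_harmonic|exact: cvg_cst].
have /(cvgr_dist_lt) /(_ (e / 4)) xl := x_cvg.
have /(cvgr_lt) /(_ (e / 4)) ml := mu_cvg.
near \oo => n.
have h1 : `|\val p - \val (x n)| < e / 4.
  by near: n; apply: xl; lra.
have h2 : mu n * Num.max B 0 < e / 4.
  by near: n; apply: ml; lra.
have h3 : \val (f (x n)) - \val (x n) = mu n *: y n.
  have /eqP := xE n; rewrite scalerDl scale1r subr_eq => /eqP ->.
  by rewrite /y (addrAC (_ - _)) subrK addrAC subrr add0r.
(* f moves x n by mu n times y n only, and x n tends to p. *)
have -> : \val (f p) - \val p = (\val (f p) - \val (f (x n))) +
   (\val (f (x n)) - \val (x n)) - (\val p - \val (x n)).
  by rewrite (addrA (_ - _)) subrK opprB addrA subrK.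
rewrite (le_trans (ler_normB _ _))//.
rewrite (le_trans (lerD (ler_normD _ _) (lexx _)))//.
have := f1 p (x n).
rewrite h3 normrZ gtr0_norm//.
have : mu n * `|y n| <= mu n * Num.max B 0 by rewrite ler_pM2l.
lra.
Unshelve. all: by end_near. Qed.

End FixedPoint.

(** * Far points of somewhat bounded sets *)

Section FarPoints.
Context {R : realType} {H : completeNormedModType R} {dot : {dot H for idfun}}.
Hypothesis dot_norm : forall x : H, dot x x = `|x| ^+ 2.

(** Let F be the span of e. In a somewhat bounded set, the component of
x - x0 in F controls the whole of x - x0: the component v orthogonal to F, once
scaled by alpha / (alpha + |u|), lies in the bounded section of C by F^perp,
so that its norm grows at most linearly with the norm of the component u in
F. Hence a point of C far from p has a large product with some [e i]. *)
Lemma norm_le_coordinates (C : set H) (C_convex : convex_set C) n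
    (e : 'I_n -> H) (x0 : H) (alpha : R) :
  C x0 -> 0 < alpha ->
  [set alpha *: v | v in lspan e `&` [set v | `|v| <= 1]]
    `<=` [set y - x0 | y in C] ->
  bounded_set (orthogonal_complement dot (lspan e) `&` [set y - x0 | y in C]) ->
  forall p : H, exists A B : R, 0 < A /\
    forall (x : H) (m : R), C x -> 0 <= m ->
      (forall i, `|dot (x - p) (e i)| <= m) ->
      `|x - p| <= B + A * m.
Proof.
move=> Cx0 a0 aC [M0 [_ M0P]]; pose M := Num.max 0 M0 + 1.
have {M0P} bM : globally
    (orthogonal_complement dot (lspan e) `&` [set y - x0 | y in C])
    [set v | `|v| <= M].
  apply: M0P; rewrite /M (@le_lt_trans _ _ (Num.max 0 M0)) ?ltrDl//.
  by rewrite le_max lexx orbT.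
have M0' : 0 < M by rewrite ltr_wpDl// le_max lexx.
have [K K0 KP] := orthogonal_projection dot_norm e.
move=> p.
pose A := (1 + M / alpha) * K + 1.
pose E := \sum_i `|e i|.
exists A, (M + A * (`|x0 - p| * E) + `|x0 - p|); split.
  by rewrite ltr_wpDl// mulr_ge0// addr_ge0// divr_ge0// ltW.
move=> x m Cx m0 xm.
pose m' := m + `|x0 - p| * E.
have m'0 : 0 <= m' by rewrite addr_ge0// mulr_ge0// sumr_ge0.
have xm' i : `|dot (x - x0) (e i)| <= m'.
  have -> : x - x0 = (x - p) - (x0 - p) by rewrite opprB addrA subrK.
  rewrite linearBl/= (le_trans (ler_normB _ _))// lerD//.
  rewrite (le_trans (normr_dot_le dot_norm _ _))// ler_wpM2l//.
  by rewrite /E (bigD1 i)//= lerDl sumr_ge0.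
have [u [eu um uo]] := KP _ _ m'0 xm'.
pose v := x - x0 - u.
have au : 0 < alpha + `|u| by rewrite ltr_pwDl.
pose s := `|u| / (alpha + `|u|).
have Cz : C (x0 - (alpha / `|u|) *: u).
  have [|y Cy] := aC (- ((alpha / `|u|) *: u)).
    exists (- (`|u|^-1 *: u)); last by rewrite scalerN scalerA.
    split; first by rewrite -scaleN1r; do 2 apply: lspanZ.
    rewrite /= normrN normrZ normfV normr_id.
    by have [->|u0] := eqVneq u 0; rewrite ?normr0 ?mulr0// mulVf ?normr_eq0.
  by move=> <-; rewrite addrC subrK.
(* The segment from x to x0 - (alpha / |u|) u meets x0 + F^perp in the point
   x0 + (alpha / (alpha + |u|)) v, which lies in C by convexity. *)
have vM : `|(alpha / (alpha + `|u|)) *: v| <= M.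
  apply: bM; split.
    by move=> t et; rewrite dotZr (uo _ et) mulr0.
  exists ((1 - s) *: x + s *: (x0 - (alpha / `|u|) *: u)).
    apply: convex_mix => //; apply/andP; split; first by rewrite divr_ge0// ltW.
    by rewrite /s ler_pdivrMr// mul1r lerDr ltW.
  have -> : alpha / (alpha + `|u|) = 1 - s by rewrite /s; field; rewrite gt_eqF.
  have : s *: ((alpha / `|u|) *: u) = (1 - s) *: u.
    have [->|u0] := eqVneq u 0; first by rewrite !scaler0.
    rewrite scalerA; congr (_ *: _).
    by rewrite /s; field; rewrite normr_eq0 u0 gt_eqF.
  move=> su; rewrite scalerBr su /v !scalerBr.
  rewrite [(1 - s) *: x0]scalerBl scale1r opprB.
  by rewrite addrA [LHS]addrAC [in RHS]addrA.
rewrite normrZ gtr0_norm ?divr_gt0// -ler_pdivlMl ?divr_gt0// in vM.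
have : `|x - p| <= `|u| + `|v| + `|x0 - p|.
  have -> : x - p = u + v + (x0 - p).
    by rewrite /v [u + _]addrC subrK addrA subrK.
  by rewrite (le_trans (ler_normD _ _))// lerD2r ler_normD.
move=> /le_trans; apply; rewrite [leRHS]addrAC lerD2r.
have -> : M + A * (`|x0 - p| * E) + A * m = M + A * m' by rewrite /m'; ring.
rewrite (le_trans (lerD (lexx _) vM))//.
rewrite invf_div.
have -> : `|u| + (alpha + `|u|) / alpha * M = M + (1 + M / alpha) * `|u|.
  by field; rewrite gt_eqF.
have h : (1 + M / alpha) * `|u| <= (1 + M / alpha) * (K * m').
  by apply: ler_wpM2l um; rewrite addr_ge0// divr_ge0// ltW.
rewrite lerD2l; apply: (le_trans h).
by rewrite [leRHS]mulrDl mul1r mulrA lerDl.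
Qed.

(** The reason why finitely many approximate values are enough to keep f
from moving far points away from p. A point x of C far from p has a product
with some [e i] comparable with its distance to p, so that one of the
points p + rho e i, p - rho e i is closer to x than p by a fixed amount. If
f sends these points within eta of p, nonexpansiveness turns this gain into
a bound on the distance from f x to p. *)
Lemma boundary_condition_near_constant (C : set H) n (e : 'I_n -> H)
    (p : H) (A B rho : R) :
  0 < A -> 0 < rho ->
  (forall (x : H) (m : R), C x -> 0 <= m ->
    (forall i, `|dot (x - p) (e i)| <= m) -> `|x - p| <= B + A * m) ->
  exists eta r : R, 0 < eta /\
    forall (z : 'I_n -> bool -> C) (f : C -> C),
    (forall i b, \val (z i b) = p + ((-1) ^+ b * rho) *: e i) ->
    nonexp_maps C f ->
    (forall i b, `|\val (f (z i b)) - p| < eta) ->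
    forall x, r < `|\val x - p| -> `|\val (f x) - p| <= `|\val x - p|.
Proof.
move=> A0 rho0 gr.
pose E := 1 + \sum_i `|e i|.
have eE i : `|e i| <= E.
  by rewrite /E (bigD1 i)//= addrCA lerDl addr_ge0// sumr_ge0.
pose eta := rho / (4 * A).
have eta0 : 0 < eta by rewrite divr_gt0// mulr_gt0.
(* Beyond 2 B the term B of the hypothesis is at most half of the distance to p;
   the second bound makes rho^2 E^2 negligible, and the third makes the distance
   to p minus eta nonnegative. *)
exists eta, (Num.max (2 * B) (Num.max (2 * A * rho * E ^+ 2) eta)); split => //.
move=> z f zE f1 fz x.
rewrite !gt_max => /and3P[]; set w := \val x - p => wB wE weta.
have w0 : 0 < `|w| by exact: lt_trans weta.
have [i iP] : exists i, `|w| / (2 * A) < `|dot w (e i)|.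
  apply/not_existsP => /(_ _)/negP wi.
  have := gr (\val x) (`|w| / (2 * A)) (in_carrier x).
  have -> : A * (`|w| / (2 * A)) = `|w| / 2 by field; rewrite gt_eqF.
  move=> /(_ _ _)/wrap[]; first by rewrite divr_ge0// ltW// mulr_gt0.
  - by move=> i; rewrite leNgt; exact: wi.
  - rewrite -/w; lra.
(* z i b is the point of the pair p +- rho e i that lies on the side of x. *)
pose b := dot w (e i) < 0.
have bE : (-1) ^+ b * dot w (e i) = `|dot w (e i)|.
  rewrite /b; case: ltP => h; first by rewrite expr1 mulN1r ltr0_norm.
  by rewrite expr0 mul1r ger0_norm.
have : `|\val (f x) - p| <= `|\val x - \val (z i b)| + eta.
  rewrite (le_trans (ler_distD (\val (f (z i b))) _ _))// lerD//.
  exact: ltW.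
move=> /le_trans; apply; rewrite -lerBrDr.
(* Moving from p to z i b shortens the distance to x by at least eta, which pays
   for the error at z i b. *)
have sq : `|\val x - \val (z i b)| ^+ 2 <= (`|w| - eta) ^+ 2.
  rewrite zE opprD addrA -/w (sqr_normB dot_norm) dotZr mulrAC bE.
  have -> : `|((-1) ^+ b * rho) *: e i| ^+ 2 = rho ^+ 2 * `|e i| ^+ 2.
    by rewrite normrZ normrMsign gtr0_norm// exprMn.
  have := eE i; have := normr_ge0 (e i) => e0 eiE.
  have h1 : rho ^+ 2 * `|e i| ^+ 2 <= rho ^+ 2 * E ^+ 2.
    by rewrite ler_pM2l ?exprn_gt0// ler_sqr// nnegrE (le_trans e0).
  have h2 : rho ^+ 2 * E ^+ 2 <= rho * `|w| / (2 * A).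
    rewrite ler_pdivlMr ?mulr_gt0//.
    have -> : rho ^+ 2 * E ^+ 2 * (2 * A) = rho * (2 * A * rho * E ^+ 2).
      by ring.
    by rewrite ler_pM2l// ltW.
  have h3 : rho * (`|w| / (2 * A)) <= `|dot w (e i)| * rho.
    by rewrite mulrC ler_pM2r// ltW.
  have -> : (`|w| - eta) ^+ 2 = `|w| ^+ 2 - rho * (`|w| / (2 * A)) + eta ^+ 2.
    by rewrite /eta; field; rewrite gt_eqF.
  have := sqr_ge0 eta.
  rewrite -mulrA in h2; lra.
by rewrite -ler_sqr ?nnegrE ?subr_ge0 ?(ltW weta).
Qed.

End FarPoints.

(** * Residual sets and pointwise convergence *)

Section Residual.
Context {T : topologicalType}.

Lemma nowhere_dense_setC (G : set T) :
  (forall (f : T) U, nbhs f U -> exists2 g, U g & G° g) ->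
  nowhere_dense (~` G).
Proof.
move=> GU; rewrite /nowhere_dense closure_setC -subset0 => f fG.
by have [g /[swap] + /(_ _)] := GU f _ fG.
Qed.

Lemma residual_bigcap (I : countType) (G : I -> set T) :
  (forall i (f : T) U, nbhs f U -> exists2 g, U g & (G i)° g) ->
  residual (\bigcap_i G i).
Proof.
move=> GU.
exists (fun n => if unpickle n is Some i then ~` G i else set0); split.
  move=> n; case: unpickle => [i|].
    by apply: nowhere_dense_setC; exact: GU.
  by rewrite /nowhere_dense closure0 interior0.
rewrite setC_bigcap; apply/seteqP; split => [f [i _ Gi]|f [n _]].
  by exists (pickle i) => //; rewrite pickleK.
by case: unpickle => // i Gi; exists i.
Qed.

End Residual.

Lemma set_type_cvgP (T : topologicalType) (A : set T) (F : set_system A)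
    {FF : Filter F} (a : A) :
  F --> a <-> \val x @[x --> F] --> \val a.
Proof.
split => [Fa|Fa].
  apply: cvg_trans; first exact: cvg_app Fa.
  exact: (@initial_continuous A T set_val).
move=> U /=.
rewrite nbhsE => -[V [[W oW <-] /= Wa] VU].
by apply: filterS VU _; apply: Fa; exact: open_nbhs_nbhs.
Qed.

Lemma nonexp_cvgP (R : realType) (H : completeNormedModType R) (C : set H)
    (F : set_system (nonexp_maps C)) {FF : Filter F} (f : nonexp_maps C) :
  F --> f <-> forall x : C, \val (\val g x) @[g --> F] --> \val (\val f x).
Proof.
have E (x : C) : (\val g x) @[g --> F] --> \val f x <->
    \val (\val g x) @[g --> F] --> \val (\val f x).
  exact: (@set_type_cvgP _ C
    ((fun g : nonexp_maps C => \val g x) @ F) _ (\val f x)).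
split => [/set_type_cvgP/pointwise_cvgP Ff x|Ff].
  exact/E/Ff.
apply/set_type_cvgP/pointwise_cvgP => x.
exact/E/Ff.
Qed.

Section NonexpansiveMaps.
Context {R : realType} {H : completeNormedModType R} {C : set H}.

Lemma nonexpE (f : nonexp_maps C) (x y : C) :
  `|\val (\val f x) - \val (\val f y)| <= `|\val x - \val y|.
Proof. by have := set_valP f => /(_ x y). Qed.

Lemma nonexp_intro (F : C -> H) : (forall x, C (F x)) ->
  (forall x y, `|F x - F y| <= `|\val x - \val y|) ->
  exists f : nonexp_maps C, forall x, \val (\val f x) = F x.
Proof.
move=> /corestriction[f fE] F1.
have f1 : nonexp_maps C f by move=> x y; rewrite !fE.
by exists (exist _ (f : {ptws C -> C}) (mem_set f1)).
Qed.

Lemma eval_cvg (f : nonexp_maps C) (x : C) :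
  \val (\val g x) @[g --> f] --> \val (\val f x).
Proof. by have /nonexp_cvgP := @cvg_id _ (nbhs f); exact. Qed.

(** The k-th iterate of g depends continuously on g because the errors do
not get amplified: g is nonexpansive. *)
Lemma iter_cvg (f : nonexp_maps C) k (x : C) :
  \val (iter k (\val g) x) @[g --> f] --> \val (iter k (\val f) x).
Proof.
have FF := nbhs_filter f.
elim: k => [|k IH]; first exact: cvg_cst.
apply/cvgrPdist_lt => e e0; near=> g.
have h1 : `|\val (iter k (\val f) x) - \val (iter k (\val g) x)| < e / 2.
  by near: g; apply: (cvgr_dist_lt _ _ IH); rewrite divr_gt0.
have h2 : `|\val (\val f (iter k (\val f) x)) -
    \val (\val g (iter k (\val f) x))| < e / 2.
  near: g; have /cvgrPdist_lt := @eval_cvg f (iter k (\val f) x).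
  by apply; rewrite divr_gt0.
have h3 := nonexpE g (iter k (\val f) x) (iter k (\val g) x).
rewrite /=.
rewrite (le_lt_trans (ler_distD (\val (\val g (iter k (\val f) x))) _ _))//.
lra.
Unshelve. all: by end_near. Qed.

Lemma iter_dist_le (f : nonexp_maps C) k (x y : C) :
  `|\val (iter k (\val f) x) - \val (iter k (\val f) y)| <= `|\val x - \val y|.
Proof. by elim: k => //= k; apply: le_trans; exact: nonexpE. Qed.

Lemma iter_dist_nonincr (f : nonexp_maps C) k l (x y : C) : (k <= l)%N ->
  `|\val (iter l (\val f) x) - \val (iter l (\val f) y)| <=
  `|\val (iter k (\val f) x) - \val (iter k (\val f) y)|.
Proof. by move=> /subnK <-; rewrite !iterD; exact: iter_dist_le. Qed.

Lemma approx_nbhs (f : nonexp_maps C) (U : set (nonexp_maps C))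
    (F : nat -> nonexp_maps C) : nbhs f U ->
  (forall x, \val (\val (F n) x) @[n --> \oo] --> \val (\val f x)) ->
  exists n, U (F n).
Proof.
move=> Uf Ff; have FU : F @ \oo --> f by apply/nonexp_cvgP.
have [N _ NU] := FU _ Uf.
by exists N; exact: (NU N (leqnn N)).
Qed.

End NonexpansiveMaps.

(** * Generic nonexpansive maps *)

Section GenericMaps.
Context {R : realType} {H : completeNormedModType R} {dot : {dot H for idfun}}.
Hypothesis dot_norm : forall x : H, dot x x = `|x| ^+ 2.
Context {C : set H}.
Hypotheses (C_closed : closed C) (C_convex : convex_set C).

Definition fixpoint_maps : set (nonexp_maps C) :=
  [set f | exists p, \val f p = p].

Definition merging_maps (x y : C) (eps : R) : set (nonexp_maps C) :=
  [set f | exists k,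
    `|\val (iter k (\val f) x) - \val (iter k (\val f) y)| < eps].

(** The maps (1 - t) f + t q converge to f pointwise as t tends to 0. *)
Lemma contractions_dense (q : C) (f : nonexp_maps C) U : nbhs f U ->
  exists (g : nonexp_maps C) (t : R), [/\ U g, 0 < t, t <= 1 &
    forall x, \val (\val g x) = (1 - t) *: \val (\val f x) + t *: \val q].
Proof.
move=> fU; pose t (n : nat) : R := n.+1%:R^-1.
have t0 n : 0 < t n by rewrite invr_gt0.
have t1 n : t n <= 1 by rewrite invf_le1 ?ltr0n// ler1n.
have /choice[F FE] n : exists g : nonexp_maps C, forall x,
    \val (\val g x) = (1 - t n) *: \val (\val f x) + t n *: \val q.
  apply: nonexp_intro => [x|x y].
    by apply: convex_mix; rewrite ?t1 ?ltW//; exact: in_carrier.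
  rewrite opprD addrACA subrr addr0 -scalerBr normrZ ger0_norm ?subr_ge0//.
  by rewrite (le_trans (ler_piMl _ _))// ?nonexpE// gerBl ltW.
have [n Un] : exists n, U (F n).
  apply: approx_nbhs fU _ => x.
  have -> : (fun n => \val (\val (F n) x)) =
     (fun n => (1 - t n) *: \val (\val f x) + t n *: \val q).
    by apply/funext => n; exact: FE.
  rewrite -[X in _ --> X]addr0 -[X in _ --> X + _]scale1r.
  rewrite -[X in _ --> _ + X](scale0r (\val q)).
  apply: cvgD; apply: cvgZ;
    [|exact: cvg_cst|exact: cvg_harmonic|exact: cvg_cst].
  rewrite -[X in _ --> X](subr0 1).
  by apply: cvgB; [exact: cvg_cst|exact: cvg_harmonic].
by exists (F n), (t n).
Qed.

(** Strict contractions merge any two orbits, they are dense, and by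
[iter_cvg] the inequality at step k persists for all maps nearby. *)
Lemma merging_maps_interior_dense (x y : C) (eps : R) (f : nonexp_maps C) U :
  0 < eps -> nbhs f U -> exists2 g, U g & (merging_maps x y eps)° g.
Proof.
move=> e0 fU; have [g [t [Ug t0 t1 gE]]] := contractions_dense x fU.
exists g => //.
have gk k : `|\val (iter k (\val g) x) - \val (iter k (\val g) y)| <=
    (1 - t) ^+ k * `|\val x - \val y|.
  elim: k => [|k IH]; first by rewrite expr0 mul1r.
  rewrite /= !gE opprD addrACA subrr addr0 -scalerBr normrZ.
  rewrite ger0_norm ?subr_ge0// exprS -mulrA ler_wpM2l ?subr_ge0//.
  by rewrite (le_trans (nonexpE _ _ _)).
have [k gke] : exists k, (1 - t) ^+ k * `|\val x - \val y| < eps.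
  have c : (1 - t) ^+ k * `|\val x - \val y| @[k --> \oo] --> 0.
    rewrite -[X in _ --> X](mul0r `|\val x - \val y|).
    apply: cvgM; last exact: cvg_cst.
    by apply: cvg_expr; rewrite ger0_norm ?subr_ge0// ltrBlDr ltrDl.
  have [k _ /(_ k (leqnn k))] := cvgr_lt _ c _ e0.
  by exists k.
have gN := nbhs_filter g.
have : `|\val (iter k (\val h) x) - \val (iter k (\val h) y)| @[h --> g] -->
    `|\val (iter k (\val g) x) - \val (iter k (\val g) y)|.
  by apply: cvg_norm; apply: cvgB; exact: iter_cvg.
move=> /cvgr_lt/(_ eps)/(_ (le_lt_trans (gk k) gke)).
by apply: filterS => h ?; exists k.
Qed.

(** A three-epsilon argument: the distance between two orbits never
increases, so merging along a dense set of starting points forces every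
orbit to approach the constant orbit of p. *)
Lemma merging_iterates_cvg (J : Type) (s : J -> C)
    (f : nonexp_maps C) (p x : C) :
  (forall (y : C) (eps : R), 0 < eps ->
    exists i, `|\val (s i) - \val y| < eps) ->
  (forall i j (eps : R), 0 < eps -> merging_maps (s i) (s j) eps f) ->
  \val f p = p ->
  \val (iter k (\val f) x) @[k --> \oo] --> \val p.
Proof.
move=> s_dense merge pE; apply/cvgrPdist_lt => e e0.
have fp k : iter k (\val f) p = p by elim: k => //= k ->.
have e3 : 0 < e / 3 by rewrite divr_gt0.
have [i ix] := s_dense x _ e3; have [j jp] := s_dense p _ e3.
have [k ke] := merge j i _ e3.
exists k => // l /= kl.
have hp := iter_dist_le f l p (s j); have hx := iter_dist_le f l (s i) x.
have hs := iter_dist_nonincr f (s j) (s i) kl.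
rewrite fp in hp; rewrite distrC in jp.
rewrite (le_lt_trans (ler_distD (\val (iter l (\val f) (s j))) _ _))//.
rewrite (le_lt_trans (lerD (lexx _)
  (ler_distD (\val (iter l (\val f) (s i))) _ _)))//.
have h1 := le_lt_trans hp jp; have h2 := le_lt_trans hx ix.
have h3 := le_lt_trans hs ke.
lra.
Qed.

(** Precompose g with the map that moves every point by at most r towards p;
it is nonexpansive, sends the ball of radius r around p to p, and tends to
the identity with r. *)
Lemma locally_constant_dense (g : nonexp_maps C) (p : C) U : nbhs g U ->
  exists (h : nonexp_maps C) (r : R), [/\ U h, 0 < r &
    forall x, `|\val x - \val p| <= r -> \val h x = \val g p].
Proof.
move=> gU; pose r (n : nat) : R := n.+1%:R^-1.
have r0 n : 0 < r n by rewrite invr_gt0.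
pose c n (x : C) := r n / Num.max (r n) `|\val x - \val p|.
have m0 n (x : C) : 0 < Num.max (r n) `|\val x - \val p| by rewrite lt_max r0.
have c0 n x : 0 <= c n x by rewrite divr_ge0// ltW.
have c1 n x : c n x <= 1 by rewrite ler_pdivrMr// mul1r le_max lexx.
have /choice[S SE] n : exists S : nonexp_maps C, forall x,
    \val (\val S x) = (1 - c n x) *: \val x + c n x *: \val p.
  apply: nonexp_intro => [x|x y].
    by apply: convex_mix; rewrite ?c0 ?c1//; exact: in_carrier.
  have E z : (1 - c n z) *: \val z + c n z *: \val p =
      (1 - c n z) *: (\val z - \val p) + \val p.
    rewrite scalerBr [(1 - c n z) *: \val p]scalerBl scale1r.
    by rewrite opprB addrA subrK.
  rewrite !E opprD addrACA subrr addr0.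
  apply: (le_trans (radial_shrink_nonexpansive dot_norm _ _ (r0 n))).
  by rewrite opprB addrA subrK.
have Sid n x : `|\val (\val (S n) x) - \val x| <= r n.
  have -> : \val (\val (S n) x) - \val x = c n x *: (\val p - \val x).
    rewrite SE scalerBl scale1r scalerBr [\val x - _]addrC (addrAC (- _)).
    by rewrite addrK addrC.
  rewrite normrZ ger0_norm// distrC /c mulrAC ler_pdivrMr// ler_pM2l//.
  by rewrite le_max lexx orbT.
have Sp n x : `|\val x - \val p| <= r n -> \val (S n) x = p.
  move=> xr; apply: val_inj; rewrite SE /c max_l// divff ?gt_eqF//.
  by rewrite subrr scale0r add0r scale1r.
have /choice[F FE] n : exists h : nonexp_maps C, forall x,
    \val (\val h x) = \val (\val g (\val (S n) x)).
  apply: nonexp_intro => [x|x y]; first exact: in_carrier.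
  by rewrite (le_trans (nonexpE _ _ _))// nonexpE.
have [n Un] : exists n, U (F n).
  apply: approx_nbhs gU _ => x.
  apply/cvgrPdist_lt => e e0.
  have : \forall n \near \oo, `|0 - r n| < e.
    exact: (cvgr_dist_lt _ _ (@cvg_harmonic R)).
  apply: filterS => n; rewrite sub0r normrN gtr0_norm// => re.
  rewrite FE (le_lt_trans _ re)// (le_trans _ (Sid n x))// distrC.
  exact: nonexpE.
exists (F n), (r n); split => // x xr.
by apply: val_inj; rewrite FE Sp.
Qed.

(** Having a fixed point is stable near maps of the following kind, which
are dense: starting from f, take a contraction g0 = (1 - t) f + t x0, with
fixed point p, and make it constant, equal to p, on a ball around p. Then
all the points p + rho e i and p - rho e i are sent to p for some small
rho > 0, and a map that is close enough to g at these finitely many points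
satisfies the condition of [fixpoint_of_boundary_condition]. *)
Lemma fixpoint_maps_interior_dense (f : nonexp_maps C) U :
  somewhat_bounded dot C -> nbhs f U -> exists2 g, U g & fixpoint_maps° g.
Proof.
move=> [_ _ [x0 [F [alpha [Cx0 [n [e ->]] a0 aC bC]]]]] fU.
pose q : C := exist _ x0 (mem_set Cx0).
have [g0 [t [Ug0 t0 t1 g0E]]] :=
  contractions_dense q (nbhs_interior fU).
have [p pE] : exists p, \val g0 p = p.
  apply: (@contraction_has_fixpoint _ _ _ C_closed (1 - t)).
  - by exists q.
  - by rewrite subr_ge0.
  - by rewrite ltrBlDr ltrDl.
  move=> x y; rewrite !g0E opprD addrACA subrr addr0 -scalerBr normrZ.
  by rewrite ger0_norm ?subr_ge0// ler_wpM2l ?subr_ge0// nonexpE.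
have [g [r [Ug r0 gp]]] := locally_constant_dense p (Ug0 : nbhs g0 U).
exists g => //.
pose E := 1 + \sum_i `|e i|.
have E0 : 0 < E by rewrite ltr_pwDl// sumr_ge0.
have eE i : `|e i| <= E.
  by rewrite /E (bigD1 i)//= addrCA lerDl addr_ge0// sumr_ge0.
pose rho := Num.min (t * alpha) r / E.
have rho0 : 0 < rho by rewrite divr_gt0// lt_min mulr_gt0.
have rho_e i : rho * `|e i| <= Num.min (t * alpha) r.
  by rewrite /rho mulrAC ler_pdivrMr// ler_wpM2l// ltW// lt_min mulr_gt0.
(* Since p = (1 - t) f p + t x0, the set C contains a t alpha - ball of F around
   p. *)
have Cz i (b : bool) : C (\val p + ((-1) ^+ b * rho) *: e i).
  have [|y Cy yE] := aC (t^-1 *: (((-1) ^+ b * rho) *: e i)).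
    exists (alpha^-1 *: (t^-1 *: (((-1) ^+ b * rho) *: e i))).
      split; first by do 3 apply: lspanZ; exact: lspan_gen.
      rewrite /= normrZ normrZ normrZ normrMsign !gtr0_norm ?invr_gt0//.
      rewrite mulrA -invfM mulrC ler_pdivrMr ?mulr_gt0// mul1r.
      rewrite [alpha * t]mulrC.
      by rewrite (le_trans (rho_e i))// ge_min lexx.
    by rewrite scalerKV ?gt_eqF.
  have -> : \val p + ((-1) ^+ b * rho) *: e i =
      (1 - t) *: \val (\val f p) + t *: y.
    rewrite -[in LHS]pE g0E /= -addrA; congr (_ + _).
    rewrite -[y](subrK x0) yE scalerDr scalerA divff ?gt_eqF// scale1r.
    exact: addrC.
  by apply: convex_mix => //; [rewrite t1 ltW|exact: in_carrier].
pose z i (b : bool) : C :=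
  exist _ (\val p + ((-1) ^+ b * rho) *: e i) (mem_set (Cz i b)).
have [A [B [A0 coord]]] :=
  norm_le_coordinates dot_norm C_convex Cx0 a0 aC bC (\val p).
have [eta [r' [eta0 bd]]] :=
  boundary_condition_near_constant dot_norm A0 rho0 coord.
have gN := nbhs_filter g.
pose close (ib : 'I_n * bool) :=
  [set h : nonexp_maps C | `|\val (\val h (z ib.1 ib.2)) - \val p| < eta].
have : \forall h \near g, forall ib, close ib h.
  apply: (@filter_forall _ _ close _ gN) => -[i b]; rewrite /close /=.
  have gz : \val g (z i b) = p.
    rewrite gp ?pE//= addrAC subrr add0r normrZ normrMsign gtr0_norm//.
    by rewrite (le_trans (rho_e i))// ge_min lexx orbT.
  have /cvgrPdist_lt/(_ _ eta0) := @eval_cvg _ _ _ g (z i b).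
  by apply: filterS => h; rewrite gz distrC.
apply: filterS => h hz.
have h1 : nonexp_maps C (\val h) := set_valP h.
have [|p' p'E] :=
  fixpoint_of_boundary_condition (B := r') (q := p)
    dot_norm C_closed C_convex h1.
  apply: (bd z) => //.
  by move=> i b; exact: (hz (i, b)).
by exists p'.
Qed.

End GenericMaps.

(** The index (a, b) selects a point of C within 1 / (b + 1) of the element
numbered a of a countable dense set, if there is one. *)
Lemma separable_dense_sequence (R : realType) (H : completeNormedModType R)
    (C : set H) :
  separable H -> C !=set0 -> exists s : nat * nat -> C,
    forall (x : C) (eps : R), 0 < eps -> exists i, `|\val (s i) - \val x| < eps.
Proof.
move=> [D cD dD] [a Ca].
have /pcard_injP[f] := cD => f_inj.
pose near_pt (ij : nat * nat) (y : C) :=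
  exists d, [/\ D d, f d = ij.1 & `|\val y - d| < ij.2.+1%:R^-1].
exists (fun ij => xget (exist _ a (mem_set Ca) : C) (near_pt ij)) => x eps e0.
have [j _ /(_ j (leqnn j)) jP] :
    \forall j \near \oo, `|0 - j.+1%:R^-1 : R| < eps / 2.
  by apply: (cvgr_dist_lt _ _ (@cvg_harmonic R)); rewrite divr_gt0.
have [d [/= xd Dd]] : ball (\val x) j.+1%:R^-1 `&` D !=set0.
  apply: dD; last exact: ball_open.
  by exists (\val x); apply: ballxx; rewrite invr_gt0.
have near_x : near_pt (f d, j) x.
  by exists d; split => //=; move: xd; rewrite -ball_normE.
exists (f d, j).
case: xgetP => [y _ [d' [Dd' /f_inj]]|/(_ x)//].
rewrite !inE => /(_ Dd' Dd) -> yd.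
move: xd jP; rewrite -ball_normE /= sub0r normrN ger0_norm ?invr_ge0// => xd je.
rewrite (le_lt_trans (ler_distD d _ _))// [`|d - _|]distrC.
rewrite [ltRHS]splitr; apply: ltrD; exact: lt_trans je.
Qed.

Theorem theorem5p3 (R : realType) (H : completeNormedModType R)
    (dot : {dot H for idfun}) (dot_norm : forall x : H, dot x x = `|x| ^+ 2)
    (H_separable : separable H) (H_infinite_dim : infinite_dimensional H)
    (C : set H) (C_closed : closed C) (C_convex : convex_set C)
    (C_somewhat_bounded : somewhat_bounded dot C)
    (C_LUR : locally_uniformly_rotund C) :
  exists2 calR : set (nonexp_maps C), residual calR &
    forall f : nonexp_maps C, calR f ->
      exists p : C,
        unique (fun q : C => \val f q = q) p /\
        forall x : C, \val (iter k (\val f) x) @[k --> \oo] --> \val p.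
Proof.
have [s s_dense] : exists s : nat * nat -> C, forall (x : C) (eps : R),
    0 < eps -> exists i, `|\val (s i) - \val x| < eps.
  by apply: separable_dense_sequence => //; case: C_somewhat_bounded.
pose I2 := (nat * nat)%type.
pose G (i : option (I2 * I2 * nat)) :=
  if i is Some (i, j, m) then merging_maps (s i) (s j) m.+1%:R^-1
  else @fixpoint_maps R H C.
exists (\bigcap_i G i).
  apply: residual_bigcap => -[[[i j] m]|] f U fU.
    have m0 : 0 < m.+1%:R^-1 :> R by rewrite invr_gt0.
    exact: (merging_maps_interior_dense C_convex _ _ m0 fU).
  exact: (fixpoint_maps_interior_dense dot_norm C_closed C_convex _ fU).
move=> f Gf; have [p pE] := Gf None I; exists p.
have cvg_p x : \val (iter k (\val f) x) @[k --> \oo] --> \val p.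
  apply: (merging_iterates_cvg x s_dense _ pE) => i j e e0.
  have [m _ /(_ m (leqnn m)) mP] :
      \forall m \near \oo, `|0 - m.+1%:R^-1 : R| < e.
    by apply: (cvgr_dist_lt _ _ (@cvg_harmonic R)).
  have [k ke] := Gf (Some (i, j, m)) I.
  exists k; apply: lt_trans ke _.
  by rewrite sub0r normrN ger0_norm ?invr_ge0 in mP.
split => //; split => // q qE.
have fq : (fun k => \val (iter k (\val f) q)) = cst (\val q).
  by apply/funext => k; elim: k => //= k /val_inj ->; rewrite qE.
apply: val_inj.
by rewrite -(cvg_lim (@norm_hausdorff _ H) (cvg_p q)) fq lim_cst.
Qed.
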